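(* Let $S$ be a finite set of positive integers with $|S|\ge 2$. Then the cumulative subtraction game $S$ converges, and its convergence position satisfies $$\xi(S)\le 2(\max S)^2 .$$
   Context: Cumulative subtraction (CS): $S$ is a finite set of positive integers with $|S|\ge 2$. A position is $(x,p)$, with $x\in\mathbb{Z}_{\ge 0}$ the number of pebbles in the heap and $p$ the score. Two players, Positive and Negative, alternate; Positive moves $(x,p)\mapsto(x-s,p+s)$ and Negative moves $(x,p)\mapsto(x-s,p-s)$, for some $s\in S$ with $s\le x$. The game ends when the heap is smaller than $\min S$. Positive starts with score $0$ and maximizes the terminal score, Negative minimizes it. Outcome function: $o:\mathbb{Z}_{\ge 0}\to\mathbb{Z}$ is defined recursively by $o(x)=0$ if $x<\min S$ and $o(x)=\max\{s-o(x-s)\mid s\in S,\ s\le x\}$ if $x\ge\min S$. Optimal action: for $x\ge\min S$, $\mathrm{opt}(x)$ is the largest $s\in S$ with $s\le x$ and $o(x)=s-o(x-s)$. Convergence: the game $S$ converges at position $x>0$ if $\mathrm{opt}(y)$ is constant over all $y\ge x$, but $\mathrm{opt}(x-1)\neq\mathrm{opt}(y)$ for $y \ge x$; this $x$ is denoted $\xi(S)$. If no such $x$ exists, the game does not converge. *)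

(* Defs.v *)
From mathcomp Require Import all_boot all_order all_algebra.
From mathcomp Require Import finmap.

Set Implicit Arguments.
Unset Strict Implicit.
Unset Printing Implicit Defensive.

Import Order.TTheory GRing.Theory Num.Theory.

Local Open Scope fset_scope.
Local Open Scope nat_scope.

(* A ruleset: a finite set of positive integers with at least two elements. *)
Definition ruleset (S : {fset nat}) : Prop :=
  (forall s, s \in S -> 0 < s) /\ 2 <= #|` S|.

Definition maxS (S : {fset nat}) : nat := \max_(s <- S) s.

(* The neutral element [maxS S] makes this the true minimum of a nonempty S. *)
Definition minS (S : {fset nat}) : nat := \big[minn/maxS S]_(s <- S) s.

(* The maximum of a nonempty list of integers; the head of the list serves as
   initial value because [int] has no least element. *)
Definition seq_max (l : seq int) : int :=
  \big[Order.max/head 0%R l]_(v <- l) v.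

(* The recursion for the outcome, with fuel [n]; [outcomeE] below shows that
   [outcome] satisfies the intended recursive equation. *)
Fixpoint outcome_rec (S : {fset nat}) (n x : nat) : int :=
  if n is n'.+1 then
    if x < minS S then 0%R
    else seq_max [seq (s%:Z - outcome_rec S n' (x - s))%R
                 | s <- [seq s <- S | s <= x]]
  else 0%R.

Definition outcome (S : {fset nat}) (x : nat) : int := outcome_rec S x.+1 x.

(* The largest s in S with s <= x and o(x) = s - o(x - s); no action exists
   when x < min S. *)
Definition opt (S : {fset nat}) (x : nat) : option nat :=
  if x < minS S then None
  else Some (\max_(s <- S | (s <= x)
                   && (outcome S x == s%:Z - outcome S (x - s))%R) s).

(* x is the convergence position xi(S), unique by [converges_at_unique].
   The value s shared by all opt(y), y >= x, is required to be an actual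
   action.  At x - 1, having no action counts as differing from s. *)
Definition converges_at (S : {fset nat}) (x : nat) : Prop :=
  0 < x /\
  exists s : nat, (forall y, x <= y -> opt S y = Some s)
               /\ opt S x.-1 <> Some s.

Definition converges (S : {fset nat}) : Prop := exists x, converges_at S x.

Lemma converges_at_unique (S : {fset nat}) (x x' : nat) :
  converges_at S x -> converges_at S x' -> x = x'.
Proof.
wlog lt_xx' : x x' / x < x'.
  move=> H Hx Hx'; case: (ltngtP x x') => // lt_; first exact: H.
  by apply/esym/H.
move=> [_ [s [Hs _]]] [x'_gt0 [s' [Hs' []]]].
have le1 : x <= x'.-1 by rewrite -ltnS prednK.
by rewrite (Hs _ le1) -(Hs x') ?(ltnW lt_xx') // Hs'.
Qed.

Lemma leq_maxS (S : {fset nat}) s : s \in S -> s <= maxS S.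
Proof. by move=> sS; rewrite /maxS; apply: (@leq_bigmax_seq _ _ xpredT (fun i => i)). Qed.

Lemma maxS_mem (S : {fset nat}) : S != fset0 -> maxS S \in S.
Proof.
case/fset0Pn=> s0 s0S.
have H : (maxS S == 0) || (maxS S \in S).
  rewrite /maxS big_seq; elim/big_ind: _ => [|a b ha hb|i iS].
  - by rewrite eqxx.
  - by rewrite /maxn; case: ifP.
  - by rewrite iS orbT.
case/orP: H => // /eqP m0; move: (leq_maxS s0S); rewrite m0 leqn0.
by move=> /eqP <-.
Qed.

Lemma minS_leq (S : {fset nat}) s : s \in S -> minS S <= s.
Proof.
rewrite /minS -[s \in S]/(s \in enum_fset S).
elim: (enum_fset S) => // a l IH; rewrite inE big_cons => /orP[/eqP->|/IH h].
  exact: geq_minl.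
by rewrite geq_min h orbT.
Qed.

Lemma minS_mem (S : {fset nat}) : S != fset0 -> minS S \in S.
Proof.
move=> S0; rewrite /minS big_seq; elim/big_ind: _ => [|a b ha hb|//].
  exact: maxS_mem.
by rewrite /minn; case: ifP.
Qed.

Lemma seq_max_ge (l : seq int) v : v \in l -> (v <= seq_max l)%R.
Proof.
rewrite /seq_max; move: (head _ _) => d.
elim: l => // a l IH; rewrite inE big_cons le_max => /orP[/eqP->|/IH ->].
  by rewrite lexx.
by rewrite orbT.
Qed.

Lemma seq_max_mem (l : seq int) : l != [::] -> seq_max l \in l.
Proof.
case: l => // a l _; rewrite /seq_max big_seq.
elim/big_ind: _ => [|u v hu hv|//]; first exact: mem_head.
by rewrite /Order.max; case: ifP.
Qed.

Lemma outcomeE (S : {fset nat}) x : ruleset S ->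
  outcome S x =
    if x < minS S then 0%R
    else seq_max [seq (s%:Z - outcome S (x - s))%R
                 | s <- [seq s <- S | s <= x]].
Proof.
move=> [Spos _].
have fuel n : forall m y, y < n -> y < m ->
    outcome_rec S n y = outcome_rec S m y.
  elim: n => // n IH [//|m] y yn ym /=; case: ifP => // _.
  congr seq_max; apply/eq_in_map => s; rewrite mem_filter => /andP[sy sS].
  have lt_ : y - s < y.
    by rewrite ltn_subrL (Spos _ sS) (leq_trans (Spos _ sS) sy).
  congr (_ - _)%R; apply: IH; exact: leq_trans lt_ _.
rewrite {1}/outcome [LHS]/=; case: ifP => // _.
congr seq_max; apply/eq_in_map => s; rewrite mem_filter => /andP[sx sS].
congr (_ - _)%R; apply: fuel => //.
by rewrite ltn_subrL (Spos _ sS) (leq_trans (Spos _ sS) sx).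
Qed.

Lemma optP (S : {fset nat}) x : ruleset S -> minS S <= x ->
  exists s, [/\ opt S x = Some s, s \in S, s <= x,
    outcome S x = (s%:Z - outcome S (x - s))%R &
    forall t, t \in S -> t <= x ->
      outcome S x = (t%:Z - outcome S (x - t))%R -> t <= s].
Proof.
move=> RS mx; have [Spos S2] := RS.
have S0 : S != fset0 by rewrite -cardfs_gt0 ltnW.
rewrite /opt ltnNge mx [~~ true]/=.
set P := fun s => (s <= x) && (outcome S x == s%:Z - outcome S (x - s))%R.
rewrite -/(P _); set m := \max_(s <- S | _) s; exists m.
have le_m t : t \in S -> P t -> t <= m.
  by move=> tS Pt; apply: (@leq_bigmax_seq _ _ P (fun i => i)).
have [t tS Pt] : exists2 t, t \in S & P t.
  have /mapP[t] : outcome S x \in [seq (s%:Z - outcome S (x - s))%R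
                                  | s <- [seq s <- S | s <= x]].
    rewrite {1}outcomeE // ltnNge mx /=; apply: seq_max_mem.
    rewrite -size_eq0 size_map size_eq0 -has_filter; apply/hasP.
    by exists (minS S) => //; exact: minS_mem.
  by rewrite mem_filter => /andP[tx tS] /eqP ot; exists t; rewrite // /P tx.
have : (m == 0) || (m \in S) && P m.
  rewrite /m big_seq_cond.
  apply: (big_ind (fun k => (k == 0) || (k \in S) && P k)) => //.
    by move=> a b ha hb; rewrite /maxn; case: (a < b).
  by move=> a aP; apply/orP; right.
case/orP => [/eqP m0|/andP[mS /andP[mx' /eqP om]]].
  by move: (le_m t tS Pt) (Spos t tS); rewrite m0 leqn0 => /eqP->.
split=> // u uS ux /eqP ou; apply: le_m => //; by rewrite /P ux.
Qed.

(* Main.v *)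
(* Write M for max S, M - mu for the second largest action, and x = 2 M q + u.
   Answering every action by M shows o(x) <= u for u <= M and o(x) >= 2 M - u
   for u >= M.  Playing M - mu until u is raised past M shows that, once q is at
   least about M / mu, the first bound is sharp up to 2 (mu - 1); this excludes
   deviations from M for M <= u < 2 M.  For u < M a deviation s at x then forces
   one at x - s - M, whose residue is u + (M - s) >= u + mu and must still be
   below M.  So there are at most about M / mu further steps, and for mu >= 2
   the two phases fit into q < M.  For mu = 1 the bound o(x) = u is exact. *)
Require Import Defs.
From mathcomp Require Import all_boot all_order all_algebra.
From mathcomp Require Import finmap.
From mathcomp Require Import zify.

Set Implicit Arguments.
Unset Strict Implicit.
Unset Printing Implicit Defensive.

Import Order.TTheory GRing.Theory Num.Theory.

Local Open Scope fset_scope.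
Local Open Scope nat_scope.

(** * Bounds on the outcome function *)

Lemma outcome_ge (S : {fset nat}) (x s : nat) :
  ruleset S -> s \in S -> s <= x -> (s%:Z - outcome S (x - s) <= outcome S x)%R.
Proof.
move=> RS sS sx; rewrite [leRHS]outcomeE // ltnNge (leq_trans (minS_leq sS) sx) /=.
by apply/seq_max_ge/mapP; exists s; rewrite // mem_filter sx.
Qed.

Lemma outcome_attained (S : {fset nat}) (x : nat) : ruleset S -> minS S <= x ->
  exists2 s, (s \in S) && (s <= x) & outcome S x = (s%:Z - outcome S (x - s))%R.
Proof.
by move=> RS mx; have [s [_ sS sx os _]] := optP RS mx; exists s; rewrite ?sS.
Qed.

Lemma outcome_small (S : {fset nat}) (x : nat) :
  ruleset S -> x < minS S -> outcome S x = 0%R.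
Proof. by move=> RS xm; rewrite outcomeE // xm. Qed.

(** The bounds feed each other: nonnegativity at [x - s] caps the value of [s] by [s], and taking
    the largest playable action leaves the opponent at most that much. *)
Lemma outcome_bounds (S : {fset nat}) (x : nat) : ruleset S ->
  (0 <= outcome S x)%R /\
  (forall b : nat, (forall s, s \in S -> s <= x -> s <= b) ->
     (outcome S x <= b%:Z)%R).
Proof.
move=> RS; have [Spos S2] := RS.
have S0 : S != fset0 by rewrite -cardfs_gt0 ltnW.
elim/ltn_ind: x => x IH; have [xm|mx] := ltnP x (minS S).
  by rewrite outcome_small.
have ltx s : s \in S -> s <= x -> x - s < x by move=> /Spos; lia.
split; last first.
  have [s /andP[sS sx] ->] := outcome_attained RS mx.
  by move=> b /(_ s sS sx); have [] := IH _ (ltx _ sS sx); lia.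
have exP : exists s, (s \in S) && (s <= x) by exists (minS S); rewrite minS_mem.
have leP s : (s \in S) && (s <= x) -> s <= x by case/andP.
case: (ex_maxnP exP leP) => s0 /andP[s0S s0x] s0max.
have [_ /(_ s0) ub] := IH _ (ltx _ s0S s0x).
have {}ub : (outcome S (x - s0) <= s0%:Z)%R.
  by apply: ub => s sS sx; apply: s0max; rewrite sS; lia.
by have := outcome_ge RS s0S s0x; lia.
Qed.

Lemma outcome_ge0 (S : {fset nat}) (x : nat) :
  ruleset S -> (0 <= outcome S x)%R.
Proof. by move=> RS; have [] := outcome_bounds x RS. Qed.

Lemma outcome_le_maxS (S : {fset nat}) (x : nat) :
  ruleset S -> (outcome S x <= (maxS S)%:Z)%R.
Proof.
by move=> RS; have [_] := outcome_bounds x RS; apply=> s sS _; apply: leq_maxS.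
Qed.

Lemma outcome_le_heap (S : {fset nat}) (x : nat) :
  ruleset S -> (outcome S x <= x%:Z)%R.
Proof. by move=> RS; have [_] := outcome_bounds x RS; apply. Qed.

Lemma maxS_in (S : {fset nat}) : ruleset S -> maxS S \in S.
Proof. by move=> [_ S2]; rewrite maxS_mem // -cardfs_gt0 ltnW. Qed.

Lemma minS_le_maxS (S : {fset nat}) : ruleset S -> minS S <= maxS S.
Proof. by move=> RS; apply/minS_leq/maxS_in. Qed.

(* Negative answers every action by max S. *)
Lemma outcome_le_even (S : {fset nat}) (q u : nat) : ruleset S -> u <= maxS S ->
  (outcome S (2 * maxS S * q + u) <= u%:Z)%R.
Proof.
move=> RS; have MS := maxS_in RS; have mM := minS_le_maxS RS.
set M := maxS S in MS mM *.
elim: q u => [|q IH] u uM; first by rewrite muln0; apply: outcome_le_heap.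
have mx : minS S <= 2 * M * q.+1 + u by lia.
have [s /andP[sS sx] ->] := outcome_attained RS mx.
have sM : s <= M by apply: leq_maxS.
have Mx : M <= 2 * M * q.+1 + u - s by lia.
have := outcome_ge RS MS Mx.
have -> : 2 * M * q.+1 + u - s - M = 2 * M * q + (u + (M - s)) by lia.
(* A residue above [M] means [s < u], so the crude bound [M] suffices there. *)
have [le|lt] := leqP (u + (M - s)) M; first by have := IH _ le; lia.
by have := outcome_le_maxS (2 * M * q + (u + (M - s))) RS; rewrite -/M; lia.
Qed.

Lemma outcome_ge_odd (S : {fset nat}) (q u : nat) : ruleset S -> maxS S <= u ->
  ((2 * maxS S)%:Z - u%:Z <= outcome S (2 * maxS S * q + u))%R.
Proof.
move=> RS; have MS := maxS_in RS; set M := maxS S in MS * => Mu.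
have [u2|u2] := leqP (2 * M) u.
  by have := outcome_ge0 (2 * M * q + u) RS; lia.
have Mx : M <= 2 * M * q + u by lia.
have := outcome_ge RS MS Mx.
have -> : 2 * M * q + u - M = 2 * M * q + (u - M) by lia.
by have := @outcome_le_even S q (u - M) RS; rewrite -/M; lia.
Qed.

(* Positive plays max S - mu on each of his first j turns. *)
Lemma outcome_ge_repeat (S : {fset nat}) (mu j q u : nat) : ruleset S ->
  mu <= maxS S -> maxS S - mu \in S -> j <= q -> maxS S <= u + j * mu ->
  ((2 * maxS S)%:Z - u%:Z - (2 * (j * mu))%:Z
     <= outcome S (2 * maxS S * q + u))%R.
Proof.
move=> RS; have mM := minS_le_maxS RS; have MS := maxS_in RS.
set M := maxS S in mM MS * => muM s2S.
elim: j q u => [|j IH] q u jq Mu.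
  by have := @outcome_ge_odd S q u RS; rewrite -/M; lia.
case: q jq => // q jq.
have sx : M - mu <= 2 * M * q.+1 + u by lia.
have mx : minS S <= 2 * M * q.+1 + u - (M - mu) by lia.
have := outcome_ge RS s2S sx.
have [t /andP[tS tx] ->] := outcome_attained RS mx.
have tM : t <= M by apply: leq_maxS.
(* The reply [t] costs [t] but raises the residue by [M - t], so [t] cancels and each round loses
   exactly [2 * mu] in the bound. *)
have -> : 2 * M * q.+1 + u - (M - mu) - t = 2 * M * q + (u + mu + (M - t)) by lia.
have Mu' : M <= u + mu + (M - t) + j * mu by lia.
have := IH q (u + mu + (M - t)) jq Mu'; lia.
Qed.

(** * Optimality of the largest action *)

(** Ties are allowed, as [opt] picks the largest optimal action. Meaningful only for [maxS S <= x],
    since subtraction truncates. *)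
Definition max_optimal (S : {fset nat}) (x : nat) : Prop :=
  outcome S x = ((maxS S)%:Z - outcome S (x - maxS S))%R.

(** The outcome is at least [2 * M - u > 0]. An action [s <= M - mu] yields a negative value if
    [u - s > M], and otherwise at most [2 * s - u + 2 * (mu - 1) <= 2 * M - u - 2]. *)
Lemma max_optimal_odd (S : {fset nat}) (mu J q u : nat) : ruleset S ->
  0 < mu <= maxS S -> maxS S - mu \in S ->
  (forall s, s \in S -> s != maxS S -> s <= maxS S - mu) ->
  maxS S <= J * mu -> J <= q.+1 -> maxS S <= u < 2 * maxS S ->
  max_optimal S (2 * maxS S * q + u).
Proof.
move=> RS; have mM := minS_le_maxS RS; have MS := maxS_in RS.
rewrite /max_optimal; set M := maxS S in mM MS *.
move=> /andP[mu0 muM] s2S le_s2 MJ Jq /andP[Mu u2].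
have mx : minS S <= 2 * M * q + u by lia.
have [s /andP[sS sx] os] := outcome_attained RS mx.
have [sM|sM] := eqVneq s M; first by rewrite os sM.
have s2 := le_s2 s sS sM.
have lb := @outcome_ge_odd S q u RS; rewrite -/M in lb; have {}lb := lb Mu.
have e : 2 * M * q + u - s = 2 * M * q + (u - s) by lia.
have [us|us] := leqP (u - s) M; last first.
  have := @outcome_ge_odd S q (u - s) RS; rewrite -/M -e; lia.
(* the least multiple of mu reaching M from u - s overshoots by less than mu *)
pose j := (M - (u - s) + mu.-1) %/ mu.
have jM : M <= u - s + j * mu.
  have := divn_eq (M - (u - s) + mu.-1) mu.
  by have := ltn_pmod (M - (u - s) + mu.-1) mu0; rewrite -/j; lia.
have jm : j * mu <= M - (u - s) + mu.-1 by apply: leq_trunc_div.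
(* Since [u - s >= mu], [j * mu < M <= J * mu]. *)
have jq : j <= q.
  have : j < J; last by lia.
  rewrite ltnNge; apply/negP => Jj; have := leq_mul Jj (leqnn mu); lia.
have := @outcome_ge_repeat S mu j q (u - s) RS muM s2S jq jM.
rewrite -/M -e; lia.
Qed.

Lemma max_optimalN (S : {fset nat}) (x : nat) : ruleset S -> maxS S <= x ->
  ~ max_optimal S x ->
  ((maxS S)%:Z - outcome S (x - maxS S) < outcome S x)%R.
Proof.
move=> RS Mx nopt; rewrite lt_neqAle outcome_ge ?maxS_in // andbT.
by apply/eqP => e; apply: nopt; rewrite /max_optimal e.
Qed.

(* A deviation s at x that M cannot match must beat the same s at x - 2M. *)
Lemma deviation_descends (S : {fset nat}) (x s : nat) : ruleset S ->
  3 * maxS S <= x -> s \in S ->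
  outcome S x = (s%:Z - outcome S (x - s))%R ->
  ~ max_optimal S x -> max_optimal S (x - maxS S) ->
  ~ max_optimal S (x - s - maxS S).
Proof.
move=> RS x3 sS os nopt; have MS := maxS_in RS; have sM := leq_maxS sS.
have := max_optimalN RS _ nopt; rewrite /max_optimal; set M := maxS S in x3 MS sM *.
move=> /(_ ltac:(lia)) dev optM opty.
(* With [o] the outcome, [opty] would give [o(x) <= s - o(x - s - 2 M) <= o(x - 2 M)], whereas [dev]
   and [optM] give [o(x - 2 M) < o(x)]. *)
have e1 := outcome_ge RS MS (_ : M <= x - s).
have e2 := outcome_ge RS sS (_ : s <= x - M - M).
have e : x - M - M - s = x - s - M - M by lia.
rewrite e in e2.
have {}e1 := e1 ltac:(lia); have {}e2 := e2 ltac:(lia); lia.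
Qed.

(** Here [i] counts descents, each lowering [q] by one; [J + i <= q.+1] keeps [max_optimal_odd]
    applicable throughout. *)
Lemma deviation_residue (S : {fset nat}) (mu J i q u : nat) : ruleset S ->
  0 < mu <= maxS S -> maxS S - mu \in S ->
  (forall s, s \in S -> s != maxS S -> s <= maxS S - mu) ->
  maxS S <= J * mu -> J + i <= q.+1 -> 1 < J -> u < maxS S ->
  ~ max_optimal S (2 * maxS S * q + u) -> u + i * mu < maxS S.
Proof.
move=> RS mu_ s2S le_s2 MJ + J1; have mM := minS_le_maxS RS.
have odd := max_optimal_odd RS mu_ s2S le_s2 MJ.
move: mu_ le_s2 odd mM; set M := maxS S => /andP[mu0 muM] le_s2 odd mM.
elim: i q u => [|i IH] [|q] u Jq uM nopt //; rewrite ?mul0n ?addn0 //; try lia.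
have mx : minS S <= 2 * M * q.+1 + u by lia.
have [s /andP[sS sx] os] := outcome_attained RS mx.
have sM : s != M.
  by apply/eqP => sM; apply: nopt; rewrite /max_optimal -/M os sM.
have s2 := le_s2 s sS sM.
have opt1 : max_optimal S (2 * M * q.+1 + u - M).
  have -> : 2 * M * q.+1 + u - M = 2 * M * q + (u + M) by lia.
  by apply: odd; lia.
have x3 : 3 * M <= 2 * M * q.+1 + u by nia.
have nopt1 := deviation_descends RS x3 sS os nopt opt1.
have e : 2 * M * q.+1 + u - s - M = 2 * M * q + (u + (M - s)) by lia.
rewrite -/M e in nopt1.
have [us|us] := ltnP (u + (M - s)) M; first by have := IH q _ _ us nopt1; lia.
by case: nopt1; apply: odd; lia.
Qed.

Lemma max_optimal_large (S : {fset nat}) (x : nat) : ruleset S ->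
  2 * maxS S ^ 2 <= x -> max_optimal S x.
Proof.
move=> RS xlarge; have [Spos S2] := RS; have MS := maxS_in RS.
have mM := minS_le_maxS RS; have M0 := Spos _ MS.
have exP : exists s, (s \in S) && (s != maxS S).
  have : 0 < #|` S `\ maxS S| by move: S2; rewrite (cardfsD1 (maxS S)) MS.
  rewrite cardfs_gt0 => /fset0Pn[s]; rewrite in_fsetD1 => /andP[sM sS].
  by exists s; rewrite sS.
have leP s : (s \in S) && (s != maxS S) -> s <= maxS S.
  by case/andP => sS _; apply: leq_maxS.
case: (ex_maxnP exP leP) => s2 /andP[s2S s2M] s2max.
have s2lt : s2 < maxS S by rewrite ltn_neqAle s2M leq_maxS.
have s20 := Spos _ s2S.
pose mu := maxS S - s2.
have mu_ : 0 < mu <= maxS S by rewrite /mu; lia.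
have muS : maxS S - mu \in S by rewrite /mu subKn // ltnW.
have le_s2 s : s \in S -> s != maxS S -> s <= maxS S - mu.
  by move=> sS sM; rewrite /mu subKn ?(ltnW s2lt) // s2max // sS.
pose q := x %/ (2 * maxS S); pose u := x %% (2 * maxS S).
have ex : x = 2 * maxS S * q + u by rewrite mulnC -divn_eq.
have u2 : u < 2 * maxS S by rewrite ltn_mod; lia.
have qM : maxS S <= q by rewrite leq_divRL; lia.
pose J := (maxS S + mu.-1) %/ mu.
have mu0 : 0 < mu by case/andP: mu_.
have MJ : maxS S <= J * mu.
  have := divn_eq (maxS S + mu.-1) mu.
  by have := ltn_pmod (maxS S + mu.-1) mu0; rewrite -/J; lia.
have Jmu : J * mu <= maxS S + mu.-1 by apply: leq_trunc_div.
have odd := max_optimal_odd RS mu_ muS le_s2 MJ.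
have JM : J <= maxS S by nia.
have [uM|uM] := leqP (maxS S) u; first by rewrite ex; apply: odd; lia.
apply/eqP; apply: contraT => /eqP nopt; exfalso.
have [mu1|mu1] := eqVneq mu 1; last first.
  have J1 : 1 < J by rewrite /mu in MJ; nia.
  (* For [mu >= 2], [J <= (M - 1) / mu + 1] gives [2 * J <= M + 1]. Then [J] descents would force
     [u + J * mu < M]. *)
  have JJ : J + J <= q.+1 by nia.
  rewrite ex in nopt.
  have := deviation_residue RS mu_ muS le_s2 MJ JJ J1 uM nopt; lia.
(* mu = 1: repeating M - 1 attains the upper bound u already at x - 2 M *)
have Mx : maxS S <= x by nia.
have dev := max_optimalN RS Mx nopt.
have := odd q.-1 (u + maxS S); rewrite /max_optimal.
have -> : 2 * maxS S * q.-1 + (u + maxS S) = x - maxS S by nia.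
have -> : x - maxS S - maxS S = 2 * maxS S * q.-1 + u by nia.
have ub := @outcome_le_even S q u RS (ltnW uM); rewrite -ex in ub.
have ge0 := outcome_ge0 (2 * maxS S * q.-1 + u) RS.
(* The case [u = 0] is separate because [maxS S - u <= q.-1] can fail when [q = maxS S]. *)
have [u0|u0] := posnP u; first by move=> /(_ ltac:(lia) ltac:(lia)); lia.
have lb := @outcome_ge_repeat S mu (maxS S - u) q.-1 u RS.
rewrite mu1 muln1 in lb muS.
have {}lb := lb ltac:(lia) muS ltac:(lia) ltac:(lia).
by move=> /(_ ltac:(lia) ltac:(lia)); lia.
Qed.

(** * From optimality to the convergence position *)

Lemma opt_max_optimal (S : {fset nat}) (x : nat) : ruleset S ->
  maxS S <= x -> max_optimal S x -> opt S x = Some (maxS S).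
Proof.
move=> RS Mx optM; have MS := maxS_in RS.
have [s [-> sS _ _ smax]] := optP RS (leq_trans (minS_le_maxS RS) Mx).
by congr Some; apply/eqP; rewrite eqn_leq leq_maxS // smax.
Qed.

(** Lower [N] while the preceding position still has action [s]; this stops above 0, where no action
    exists. *)
Lemma converges_before (S : {fset nat}) (s N : nat) : ruleset S ->
  (forall y, N <= y -> opt S y = Some s) ->
  exists2 x, x <= N & converges_at S x.
Proof.
move=> [Spos S2]; elim: N => [|N IH] optN.
  have m0 : 0 < minS S by apply/Spos/minS_mem; rewrite -cardfs_gt0 ltnW.
  by have := optN 0 isT; rewrite /opt m0.
have [e|ne] := eqVneq (opt S N) (Some s); last first.
  by exists N.+1 => //; split=> //; exists s; split=> //; apply/eqP.
have [|x xN cx] := IH; last by exists x; rewrite // ltnW.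
by move=> y; rewrite leq_eqVlt => /orP[/eqP <-|/optN].
Qed.

Theorem theorem3 (S : {fset nat}) (hS : ruleset S) :
  converges S /\ (forall x : nat, converges_at S x -> (x <= 2 * maxS S ^ 2)%N).
Proof.
have [x xle cx] : exists2 x, x <= 2 * maxS S ^ 2 & converges_at S x.
  apply: (@converges_before S (maxS S)) => // y ley.
  apply: opt_max_optimal => //; last exact: max_optimal_large.
  by apply: leq_trans ley; have := hS.1 _ (maxS_in hS); nia.
by split=> [|x' cx']; [exists x | rewrite (converges_at_unique cx' cx)].
Qed.
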